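(* Let $A_1=P_1J_1P_1^{-1}$ with $J_1=\mathrm{diag}(-p_1,-q_1)$, $0<p_1<q_1$, and $A_2=P_2J_2P_2^{-1}$ with $J_2=\mathrm{diag}(p_2,q_2)$, where either $0<p_2<q_2$ or $p_2\le 0<q_2$; here $P_1,P_2$ are real invertible $2\times 2$ matrices chosen such that $M=P_2^{-1}P_1$ has determinant $1$. Let $\epsilon>0$ and $\eta>0$ be given. (i) If at least one of the off-diagonal entries of $M$ is zero, let $\tau_{1,2}(\eta)=\max\left(\frac{q_2}{q_1},\frac{p_2}{p_1}\right)\eta+\epsilon$. (ii) If at least one of the diagonal entries of $M$ is zero, let $\tau_{1,2}(\eta)=\frac{q_2}{p_1}\eta+\epsilon$. Then the switched system $\dot x(t)=A_{\sigma(t)}x(t)$ is asymptotically stable for all signals $\sigma\in\mathcal S[\tau_{1,2}(\eta),\eta]$.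
   Context: Planar switched system: $\dot x(t)=A_{\sigma(t)}x(t)$, $x(t)\in\mathbb R^2$ continuous in $t\ge0$, with $A_1,A_2$ real $2\times2$ matrices. A switching signal $\sigma:[0,\infty)\to\{1,2\}$ is right-continuous and piecewise constant with infinitely many discontinuities $0<d_1<d_2<\cdots$, $d_k\to\infty$; set $d_0=0$. For a signal with $\sigma(0)=1$ put $t_k=d_{2k-1}-d_{2k-2}$ (times spent in $A_1$) and $s_k=d_{2k}-d_{2k-1}$ (times spent in $A_2$), $k\ge1$. For $\tau,\eta>0$, $\mathcal S[\tau,\eta]$ is the set of signals with $\sigma(0)=1$, $t_k\ge\tau$ and $s_k\le\eta$ for all $k\in\mathbb N$. For a given signal $\sigma$, the system is stable if for every $\varepsilon'>0$ there is $\delta>0$ such that $\|x(0)\|<\delta$ implies $\|x(t)\|<\varepsilon'$ for all $t>0$; it is asymptotically stable if it is stable and $\|x(t)\|\to0$ as $t\to\infty$ for every $x(0)\in\mathbb R^2$. Norms are Euclidean. *)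

(* Defs.v *)
From HB Require Import structures.
From mathcomp Require Import all_boot all_order all_algebra.
From mathcomp Require Import all_classical all_reals all_analysis.
Set Implicit Arguments.
Unset Strict Implicit.
Unset Printing Implicit Defensive.
Import Order.TTheory GRing.Theory Num.Theory.
Import numFieldNormedType.Exports.
Local Open Scope classical_set_scope.
Local Open Scope ring_scope.

Definition diag2 (R : realType) (a b : R) : 'M[R]_2 :=
  diag_mx (\row_(j < 2) [:: a; b]`_j).

(* The library norm on matrices is the max norm, not the Euclidean one. *)
Definition euclidean_norm (R : realType) (v : 'cV[R]_2) : R :=
  Num.sqrt (\sum_(i < 2) v i 0 ^+ 2).

Inductive mode := Mode1 | Mode2.

Definition subsystem (R : realType) (A1 A2 : 'M[R]_2) (m : mode) : 'M[R]_2 :=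
  match m with Mode1 => A1 | Mode2 => A2 end.

(* Signals and trajectories are functions on all of R, but only their values on
   [0, +oo[ are ever constrained or used. *)

(* d 1 < d 2 < ... are exactly the discontinuities of sigma on [0, +oo[, and
   d 0 = 0.  Constancy on the half-open intervals [d k, d k.+1[ gives both
   piecewise constancy and right-continuity. *)
Definition switching_times (R : realType) (sigma : R -> mode) (d : nat -> R) :
    Prop :=
  [/\ d 0%N = 0,
      forall k, d k < d k.+1,
      d @ \oo --> +oo,
      forall k t, d k <= t < d k.+1 -> sigma t = sigma (d k) &
      forall k, sigma (d k.+1) <> sigma (d k)].

(* The class S[tau, eta].  Indices are shifted by one: the k-th stay (k >= 0)
   in mode 1 is [d (2k), d (2k+1)[, in mode 2 it is [d (2k+1), d (2k+2)[. *)
Definition dwell_flee (R : realType) (tau eta : R) : set (R -> mode) :=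
  [set sigma | exists d : nat -> R,
    [/\ switching_times sigma d,
        sigma 0 = Mode1,
        forall k, tau <= d k.*2.+1 - d k.*2 &
        forall k, d k.*2.+2 - d k.*2.+1 <= eta]].

(* The differential equation is imposed at every t > 0 near which sigma is
   constant, i.e. away from the switching times. *)
Definition trajectory (R : realType) (A : mode -> 'M[R]_2) (sigma : R -> mode)
    (x : R -> 'cV[R]_2) : Prop :=
  {within `[0, +oo[, continuous x} /\
  forall t : R, 0 < t -> (\forall s \near t, sigma s = sigma t) ->
    is_derive t (1 : R) x (A (sigma t) *m x t).

Definition stable (R : realType) (A : mode -> 'M[R]_2) (sigma : R -> mode) :
    Prop :=
  forall e : R, 0 < e -> exists2 delta : R, 0 < delta &
    forall x : R -> 'cV[R]_2, trajectory A sigma x ->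
      euclidean_norm (x 0) < delta ->
      forall t : R, 0 < t -> euclidean_norm (x t) < e.

Definition asymptotically_stable (R : realType) (A : mode -> 'M[R]_2)
    (sigma : R -> mode) : Prop :=
  stable A sigma /\
  forall x : R -> 'cV[R]_2, trajectory A sigma x ->
    euclidean_norm (x t) @[t --> +oo] --> (0 : R).

(* Main.v *)
Require Import Defs.
From HB Require Import structures.
From mathcomp Require Import all_boot all_order all_algebra.
From mathcomp Require Import all_classical all_reals all_analysis.
From mathcomp Require Import ring lra.
Set Implicit Arguments.
Unset Strict Implicit.
Unset Printing Implicit Defensive.
Import Order.TTheory GRing.Theory Num.Theory.
Import numFieldNormedType.Exports.
Local Open Scope classical_set_scope.
Local Open Scope ring_scope.

(** Write y = P1^-1 x and z = P2^-1 x = M y for the coordinates that diagonalize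
A1 and A2.  On a stay in either mode the matching coordinates evolve as
exponentials ([diag_flow_on_stay]).

All four cases say that M has one zero entry M i j.  Let i' and j' be the other
indices.  Then z_i is a multiple of y_j' and z_i' is a multiple of y_j + k y_j'
for some k.  So, with u = y_j and v = y_j', the coordinate v is an eigencoordinate
in both modes, while u is one in the first mode and w = u + k v is one in the
second.  A period, h units of time in mode 1 and s in mode 2, acts on (w, v) by a
triangular matrix with diagonal entries
  exp(lam_j h + mu_i' s)  and  exp(lam_j' h + mu_i s).
The dwell time is chosen so that both exponents are negative, uniformly in
h >= tau and 0 <= s <= eta.  The off-diagonal entry stays bounded even for
arbitrarily long stays in mode 1, since that mode is contracting, so giving v a
large weight K in |w| + K |v| makes every period a contraction with one common
ratio r < 1 ([skew_norm_contraction]).  Within a period this norm grows by a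
bounded factor only, so the Euclidean norm of x is at most C r^n times its initial
value after n periods, which gives both stability and attraction
([asymptotically_stable_geometric], [triangular_asymptotically_stable]).

An off-diagonal zero of M pairs p1 with p2 and q1 with q2, whence the maximum of
q2/q1 and p2/p1 in case (i).  A diagonal zero pairs p1 with q2 and q1 with p2, and
q2/p1 is then the larger ratio, whence case (ii). *)

(** * Linear flows in diagonalizing coordinates *)

Lemma linear_ode_sol (R : realType) (f : R -> R) (c a b : R) : a <= b ->
  {within `[a, b], continuous f} ->
  (forall t, a < t < b -> is_derive t 1 f (c * f t)) ->
  f b = expR (c * (b - a)) * f a.
Proof.
move=> ab cf df.
(* The integrating factor makes the product constant. *)
pose e := fun t : R => expR (- c * t).
have de (t : R) : is_derive t 1 e (- c * e t).
  have dl : is_derive t 1 (fun s : R => - c * s) (- c).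
    have := is_deriveZ (f := id) (- c) (is_derive_id t (1 : R)).
    by rewrite /GRing.scale /= mulr1.
  by have := is_derive1_comp (is_derive_expR (- c * t)) dl; rewrite mulrC.
have [t _] : exists2 t, t \in `[a, b] & (e * f) b - (e * f) a = 0 * (b - a).
  apply: (@MVT_segment _ _ (fun=> 0)) => //.
    move=> t; rewrite in_itv /= => /df dft.
    apply: is_derive_eq (is_deriveM (de t) dft) _.
    by rewrite /GRing.scale /=; ring.
  move=> t; apply: continuousM; last exact: cf.
  apply: continuous_subspaceT => s.
  by apply: differentiable_continuous; apply/derivable1_diffP; case: (de s).
rewrite mul0r => /subr0_eq efab.
apply: (mulfI (lt0r_neq0 (expR_gt0 (- c * b)))).
rewrite [LHS]efab [LHS]/GRing.mul /= /e mulrA -expRD; congr (expR _ * _); ring.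
Qed.

(** Each coordinate of P^-1 x is a finite linear combination of entries of x, so it
inherits continuity and satisfies a scalar equation. *)
Lemma diag_flow_coord (R : realType) (n : nat) (P : 'M[R]_n) (lam : 'rV[R]_n)
    (x : R -> 'cV[R]_n) (a b : R) :
  P \in unitmx -> a <= b -> {within `[a, b], continuous x} ->
  (forall t, a < t < b ->
    is_derive t (1 : R) x (P *m diag_mx lam *m invmx P *m x t)) ->
  forall i, (invmx P *m x b) i 0
            = expR (lam 0 i * (b - a)) * (invmx P *m x a) i 0.
Proof.
move=> Pu ab cx dx i.
have yE t : (invmx P *m x t) i 0 = (\sum_j (fun s => invmx P i j * x s j 0)) t.
  by rewrite fct_sumE mxE.
rewrite !yE; apply: linear_ode_sol => // [|t tab].
  have cE : (fun v : 'cV[R]_n => (invmx P *m v) i 0) \o x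
      = \sum_j (fun s => invmx P i j * x s j 0).
    by apply/funext => t /=; rewrite yE.
  rewrite -cE; apply: within_continuous_comp => // v _.
  have -> : (fun v : 'cV[R]_n => (invmx P *m v) i 0)
      = \sum_j (fun v => invmx P i j * v j 0).
    by apply/funext => w; rewrite fct_sumE mxE.
  elim/big_ind: _ => [|f g cf cg|j _]; first exact: cst_continuous.
  - exact: continuousD.
  - by apply: continuousM; [exact: cst_continuous | exact: coord_continuous].
have dxt := dx t tab.
have dxj (j : 'I_n) : is_derive t (1 : R) (fun s => x s j 0)
    ((P *m diag_mx lam *m invmx P *m x t) j 0).
  have dd : derivable x t 1 by case: dxt.
  split; first exact: (derivable_mxP x t 1).1 dd j 0.
  by have := derive_mx dd; rewrite derive_val => ->; rewrite mxE.
have := is_derive_sum (fun j => is_deriveZ (invmx P i j) (dxj j)).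
move=> dsum; apply: is_derive_eq dsum _.
rewrite -yE.
transitivity ((invmx P *m (P *m diag_mx lam *m invmx P *m x t)) i 0).
  by rewrite [RHS]mxE.
by rewrite !mulmxA mulVmx // mul1mx -mulmxA mul_diag_mx mxE.
Qed.

(** * A weighted norm contracted by each period *)

(** The weighted l^1 norm in the sheared coordinates (u + k v, v). *)
Definition skew_norm (R : realType) (k K u v : R) : R := `|u + k * v| + K * `|v|.

(** The exponent is largest at h = tau and at an endpoint of [0, eta]: at s = 0 when
b <= 0, at s = eta otherwise. *)
Lemma expR_rate_le (R : realType) (a b tau eta h s : R) :
  a < 0 -> tau <= h -> 0 <= s <= eta ->
  expR (a * h + b * s) <= expR (Num.max (a * tau) (a * tau + b * eta)).
Proof.
move=> a0 tauh /andP[s0 seta]; rewrite ler_expR le_max.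
have aht : a * h <= a * tau by rewrite ler_wnM2l // ltW.
case: (leP b 0) => b0; apply/orP; [left|right].
  by have := mulr_le0_ge0 b0 s0; lra.
by have := ler_wpM2l (ltW b0) seta; lra.
Qed.

(** Here (u0, v0) is the state when mode 1 starts, and (u, v) the state after h units
of time in mode 1 and s in mode 2.  In terms of w = u + k v the new w is
e1 w0 + S v0 with |S| <= |k| G, and the new v is e2 v0.  When h >= tau, both e1 and
e2 are at most r0 < 1, and the weight K absorbs S at the price of raising the ratio
from r0 to the midpoint (1 + r0) / 2.  The bound by B holds also for h < tau and so
controls incomplete periods; s = 0 covers instants of mode 1. *)
Lemma skew_norm_contraction (R : realType) (a1 a2 b1 b2 k tau eta : R) :
  a1 < 0 -> a2 < 0 -> 0 < tau ->
  a1 * tau + b1 * eta < 0 -> a2 * tau + b2 * eta < 0 ->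
  exists K B r : R, [/\ 1 <= K, 0 <= B, 0 <= r < 1 &
    forall h s u0 v0 u v, 0 <= h -> 0 <= s <= eta ->
      u + k * v = expR (b1 * s) * (expR (a1 * h) * u0 + k * (expR (a2 * h) * v0)) ->
      v = expR (b2 * s) * (expR (a2 * h) * v0) ->
      skew_norm k K u v <= B * skew_norm k K u0 v0 /\
      (tau <= h -> skew_norm k K u v <= r * skew_norm k K u0 v0)].
Proof.
move=> a10 a20 tau0 ab1 ab2.
pose m1 := Num.max (a1 * tau) (a1 * tau + b1 * eta).
pose m2 := Num.max (a2 * tau) (a2 * tau + b2 * eta).
pose r0 := expR (Num.max m1 m2).
pose G := expR ((`|b1| + `|b2|) * eta).
have r0_lt1 : r0 < 1.
  by rewrite expR_lt1 !gt_max ab1 ab2 !nmulr_rlt0 // tau0.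
have r0_gt0 : 0 < r0 by exact: expR_gt0.
have G_gt0 : 0 < G by exact: expR_gt0.
have k0 := normr_ge0 k.
have kG0 : 0 <= `|k| * G by rewrite mulr_ge0 // ltW.
(* K is chosen so that |k| G + K r0 <= K (1 + r0) / 2. *)
pose K := 1 + 2 * (`|k| * G) / (1 - r0).
have K1 : 1 <= K.
  by rewrite /K lerDl divr_ge0 ?mulr_ge0 // ?subr_ge0 ltW.
have kGK : `|k| * G <= K * ((1 - r0) / 2).
  rewrite /K mulrDl mul1r.
  have -> : 2 * (`|k| * G) / (1 - r0) * ((1 - r0) / 2) = `|k| * G.
    by field; rewrite subr_eq0 gt_eqF.
  by rewrite lerDr divr_ge0 // subr_ge0 ltW.
clearbody K.
exists K, (G * (1 + `|k|)), ((1 + r0) / 2); split => //.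
- by rewrite mulr_ge0 ?addr_ge0 // ltW.
- by apply/andP; split; lra.
move=> h s u0 v0 u v h0 /[dup] sI /andP[s0 seta] uvE vE.
pose e1 := expR (a1 * h + b1 * s); pose e2 := expR (a2 * h + b2 * s).
have eta0 : 0 <= eta by exact: le_trans s0 seta.
have bG (b c : R) : b * s <= (`|b| + `|c|) * eta.
  apply: le_trans (_ : `|b| * s <= _); first by rewrite ler_wpM2r // ler_norm.
  by rewrite ler_pM // lerDl.
have ah (a : R) : a < 0 -> a * h <= 0 by move=> a0; rewrite mulr_le0_ge0 // ltW.
have e1G : e1 <= G.
  by rewrite ler_expR; have := bG b1 b2; have := ah a1 a10; lra.
have e2G : e2 <= G.
  by rewrite ler_expR; have := bG b2 b1; have := ah a2 a20; lra.
have wE : u + k * v = e1 * (u0 + k * v0)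
    + k * (expR (b1 * s) * (expR (a2 * h) - expR (a1 * h))) * v0.
  by rewrite uvE /e1 expRD; ring.
have skew : `|expR (b1 * s) * (expR (a2 * h) - expR (a1 * h))| <= G.
  rewrite normrM gtr0_norm ?expR_gt0 // -[leRHS]mulr1 ler_pM ?expR_ge0 //.
    by rewrite ler_expR.
  have := expR_gt0 (a1 * h); have := expR_gt0 (a2 * h).
  have : expR (a1 * h) <= 1 by rewrite expR_le1 ah.
  have : expR (a2 * h) <= 1 by rewrite expR_le1 ah.
  by rewrite ler_norml => *; apply/andP; split; lra.
have Vle : skew_norm k K u v
    <= e1 * `|u0 + k * v0| + (`|k| * G + K * e2) * `|v0|.
  rewrite /skew_norm wE vE [expR (b2 * s) * _]mulrA -expRD [b2 * s + _]addrC -/e2.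
  rewrite [`|e2 * _|]normrM (gtr0_norm (expR_gt0 _)) mulrDl addrA -!mulrA lerD2r.
  rewrite (le_trans (ler_normD _ _)) // normrM (gtr0_norm (expR_gt0 _)) lerD2l.
  by rewrite normrM ler_wpM2l // mulrA normrM ler_wpM2r.
have w0 := normr_ge0 (u0 + k * v0); have n0 := normr_ge0 v0.
split=> [|tauh]; apply: le_trans Vle _; rewrite /skew_norm mulrDr lerD //.
- by rewrite ler_wpM2r // (le_trans e1G) // ler_peMr ?lerDl // ltW.
- rewrite mulrA ler_wpM2r //.
  apply: le_trans (_ : `|k| * G + K * G <= _).
    by rewrite lerD2l ler_wpM2l //; lra.
  have := ler_wpM2l kG0 K1; lra.
- rewrite ler_wpM2r //; apply: le_trans (_ : r0 <= _); last by lra.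
  apply: le_trans (expR_rate_le b1 a10 tauh sI) _.
  by rewrite ler_expR le_max lexx.
- rewrite mulrA ler_wpM2r //.
  have : e2 <= r0.
    apply: le_trans (expR_rate_le b2 a20 tauh sI) _.
    by rewrite ler_expR le_max lexx orbT.
  by move=> /(ler_wpM2l (le_trans ler01 K1)); lra.
Qed.

(** * Comparison with the Euclidean norm *)

Lemma normr_le_euclidean (R : realType) (v : 'cV[R]_2) i :
  `|v i 0| <= euclidean_norm v.
Proof.
rewrite -sqrtr_sqr ler_wsqrtr // (bigD1 i) //= lerDl sumr_ge0 // => j _.
exact: sqr_ge0.
Qed.

Lemma euclidean_le_sum (R : realType) (v : 'cV[R]_2) :
  euclidean_norm v <= \sum_i `|v i 0|.
Proof.
rewrite /euclidean_norm !big_ord_recl !big_ord0 !addr0.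
set a := v _ _; set b := v _ _.
have ab0 : 0 <= `|a| + `|b| by rewrite addr_ge0.
rewrite -[leRHS](ger0_norm ab0) -sqrtr_sqr ler_wsqrtr //.
rewrite sqrrD !real_normK ?num_real // -addrA lerD2l lerDr.
by rewrite mulrn_wge0 // mulr_ge0.
Qed.

Lemma mulmx_sum_le (R : realType) m n (N : 'M[R]_(m, n)) (v : 'cV[R]_n) :
  \sum_i `|(N *m v) i 0| <= (\sum_i \sum_j `|N i j|) * \sum_j `|v j 0|.
Proof.
rewrite mulr_suml ler_sum // => i _; rewrite mxE mulr_suml.
apply: le_trans (ler_norm_sum _ _ _) _; apply: ler_sum => j _.
rewrite normrM ler_wpM2l // (bigD1 j) //= lerDl.
by apply: sumr_ge0.
Qed.

(** * From geometric decay to asymptotic stability *)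

(** C and r do not depend on the trajectory: stability is the case k = 0 of the
bound, and attraction follows from r^k -> 0. *)
Lemma asymptotically_stable_geometric (R : realType) (A : mode -> 'M[R]_2)
    (sigma : R -> mode) (T : nat -> R) (C r : R) :
  0 <= C -> 0 <= r < 1 -> T 0%N = 0 ->
  (forall x, trajectory A sigma x -> forall k t, T k <= t ->
    euclidean_norm (x t) <= C * r ^+ k * euclidean_norm (x 0)) ->
  asymptotically_stable A sigma.
Proof.
move=> C0 /andP[r0 r1] T0 bound; split.
  move=> e e0; have C1 : 0 < C + 1 by lra.
  exists (e / (C + 1)) => [|x xtraj x0 t t0]; first by rewrite divr_gt0.
  apply: le_lt_trans (bound x xtraj 0%N t _) _; first by rewrite T0 ltW.
  rewrite expr0 mulr1; move: x0; rewrite ltr_pdivlMr //.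
  have : 0 <= euclidean_norm (x 0) by exact: sqrtr_ge0.
  lra.
move=> x xtraj; apply/cvgrPdist_lt => e e0.
have : geometric (C * euclidean_norm (x 0)) r n @[n --> \oo] --> 0.
  by apply: cvg_geometric; rewrite ger0_norm.
move=> /cvgrPdist_lt /(_ e e0) [n _ /(_ n (leqnn n))] /=.
rewrite !sub0r !normrN => small.
near=> t; rewrite sub0r normrN ger0_norm ?sqrtr_ge0 //.
apply: le_lt_trans (bound x xtraj n t _) _.
  by near: t; apply: nbhs_pinfty_ge; exact: num_real.
by apply: le_lt_trans small; rewrite mulrAC ler_norm.
Unshelve. all: by end_near. Qed.

(** * Stays and periods of a switching signal *)

Lemma switching_times_ge0 (R : realType) (sigma : R -> mode) d :
  switching_times sigma d -> forall k, 0 <= d k.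
Proof.
move=> [d0 dS _ _ _]; elim=> [|k IH]; first by rewrite d0.
exact: le_trans IH (ltW (dS k)).
Qed.

Lemma modes_alternate (R : realType) (sigma : R -> mode) d :
  switching_times sigma d -> sigma 0 = Mode1 ->
  forall k, sigma (d k.*2) = Mode1 /\ sigma (d k.*2.+1) = Mode2.
Proof.
move=> [d0 _ _ _ dchange] s0.
have flip1 k : sigma (d k) = Mode1 -> sigma (d k.+1) = Mode2.
  by have := dchange k; case: (sigma (d k.+1)) => // + H; rewrite H.
have flip2 k : sigma (d k) = Mode2 -> sigma (d k.+1) = Mode1.
  by have := dchange k; case: (sigma (d k.+1)) => // + H; rewrite H.
elim=> [|k [_ IH]].
  rewrite -[_.*2]/0%N d0; split=> //.
  by apply: flip1; rewrite d0.
rewrite doubleS; split; first exact: flip2.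
exact/flip1/flip2.
Qed.

(** Since d tends to infinity, every instant lies in some period, taken to be the
last one that starts by time t. *)
Lemma switching_period (R : realType) (sigma : R -> mode) d n (t : R) :
  switching_times sigma d -> d n.*2 <= t ->
  exists2 m, (n <= m)%N & d m.*2 <= t <= d m.*2.+2.
Proof.
move=> [d0 dS doo _ _] nt.
have dmono : {homo d : k l / (k <= l)%N >-> k <= l}.
  by apply/nondecreasing_seqP => k; exact: ltW.
have ex : exists m, t < d m.*2.
  have /cvgryPgt /(_ t) [m _ mP] := doo.
  by exists m; apply: mP; rewrite /= -addnn leq_addr.
case: (ex_minnP ex) => m tm mmin.
have nm : (n < m)%N.
  rewrite ltnNge; apply/negP => mn.
  have dmn : d m.*2 <= d n.*2 by apply: dmono; rewrite leq_double.
  by have := lt_le_trans tm (le_trans dmn nt); rewrite ltxx.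
case: m => // m in tm mmin nm *; exists m; first by [].
rewrite (ltW tm) andbT leNgt; apply/negP => /mmin.
by rewrite ltnn.
Qed.

(** The flow is valid up to and including the switching time d k.+1, by continuity
of the trajectory. *)
Lemma diag_flow_on_stay (R : realType) (A : mode -> 'M[R]_2) sigma d x k t
    (P : 'M[R]_2) (lam : 'rV[R]_2) :
  switching_times sigma d -> trajectory A sigma x ->
  A (sigma (d k)) = P *m diag_mx lam *m invmx P -> P \in unitmx ->
  d k <= t <= d k.+1 ->
  forall i, (invmx P *m x t) i 0
            = expR (lam 0 i * (t - d k)) * (invmx P *m x (d k)) i 0.
Proof.
move=> swd [xc dx] AE Pu /andP[kt tk].
have dk0 := switching_times_ge0 swd k.
have [_ _ _ dconst _] := swd.
apply: diag_flow_coord => //.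
  apply: continuous_subspaceW xc => s /=.
  by rewrite !in_itv /= andbT => /andP[]; lra.
move=> s /andP[ks st].
have sE s' : d k < s' -> s' < d k.+1 -> sigma s' = sigma (d k).
  by move=> ? ?; apply: dconst; apply/andP; split=> //; exact: ltW.
have sk : s < d k.+1 by exact: lt_le_trans st tk.
rewrite -AE -(sE s) //; apply: dx; first exact: le_lt_trans ks.
near=> s'; rewrite sE ?sE //; near: s'; [exact: lt_nbhsr|exact: lt_nbhsl].
Unshelve. all: by end_near. Qed.

(** * Coordinate changes with a zero entry *)

Lemma sum_I2 (V : nmodType) (F : 'I_2 -> V) (j j' : 'I_2) :
  j != j' -> \sum_l F l = F j + F j'.
Proof.
move=> jj'; rewrite (bigD1 j) // (bigD1 j') 1?eq_sym //= big1 ?addr0 // => l.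
case: l j j' jj' => [[|[|?]]] // ? [[|[|?]]] // ? [[|[|?]]] //.
Qed.

(** With M i j = 0, a further zero at (i, j') would annihilate row i, and one at
(i', j) would annihilate column j. *)
Lemma unitmx2_antidiag (F : fieldType) (M : 'M[F]_2) i i' j j' :
  i != i' -> j != j' -> M \in unitmx -> M i j = 0 ->
  M i j' != 0 /\ M i' j != 0.
Proof.
move=> ii' jj' Mu Mij; split; apply/eqP => M0; have /eqP := oner_neq0 F; apply.
- have /matrixP/(_ i i) := mulmxV Mu.
  by rewrite !mxE eqxx (sum_I2 _ jj') Mij M0 !mul0r addr0 => /esym.
- have /matrixP/(_ j j) := mulVmx Mu.
  by rewrite !mxE eqxx (sum_I2 _ ii') Mij M0 !mulr0 addr0 => /esym.
Qed.

(** The zero entry (i, j) couples the rate lam_j with mu_i' and lam_j' with mu_i.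
Leaving the position of the zero free lets the upper and lower triangular cases
and the two cases of a diagonal zero be instances of one statement. *)
Lemma triangular_asymptotically_stable (R : realType) (P1 P2 : 'M[R]_2)
    (lam mu : 'rV[R]_2) (i i' j j' : 'I_2) (tau eta : R) sigma :
  P1 \in unitmx -> P2 \in unitmx -> i != i' -> j != j' ->
  (invmx P2 *m P1) i j = 0 ->
  lam 0 j < 0 -> lam 0 j' < 0 -> 0 < tau ->
  lam 0 j * tau + mu 0 i' * eta < 0 -> lam 0 j' * tau + mu 0 i * eta < 0 ->
  dwell_flee tau eta sigma ->
  asymptotically_stable (subsystem (P1 *m diag_mx lam *m invmx P1)
                                   (P2 *m diag_mx mu *m invmx P2)) sigma.
Proof.
set M := invmx P2 *m P1.
move=> P1u P2u ii' jj' Mij lj lj' tau0 rj rj' [d [swd s0 dwell flee]].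
have Mu : M \in unitmx by rewrite unitmx_mul unitmx_inv P2u.
have [Mij' Mi'j] := unitmx2_antidiag ii' jj' Mu Mij.
(* This shear makes z_i' proportional to y_j + k y_j'. *)
pose k := M i' j' / M i' j.
have [K [B [r [K1 B0 r01 contr]]]] := skew_norm_contraction k lj lj' tau0 rj rj'.
have r0 : 0 <= r by case/andP: r01.
pose V (x : 'cV[R]_2) :=
  skew_norm k K ((invmx P1 *m x) j 0) ((invmx P1 *m x) j' 0).
have zE (x : 'cV[R]_2) l :
    (invmx P2 *m x) l 0 = \sum_m M l m * (invmx P1 *m x) m 0.
  by rewrite -[invmx P2](mulmxK P1u) -/M -mulmxA mxE.
have ziE (x : 'cV[R]_2) : (invmx P2 *m x) i 0 = M i j' * (invmx P1 *m x) j' 0.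
  by rewrite zE (sum_I2 _ jj') Mij mul0r add0r.
have zi'E (x : 'cV[R]_2) : (invmx P2 *m x) i' 0
    = M i' j * ((invmx P1 *m x) j 0 + k * (invmx P1 *m x) j' 0).
  by rewrite zE (sum_I2 _ jj') /k; field.
(* Comparison of V with the Euclidean norm, through the entries of P1^-1 and P1. *)
pose C1 := \sum_l \sum_m `|invmx P1 l m|; pose C2 := \sum_l \sum_m `|P1 l m|.
have C1_ge0 : 0 <= C1 by do 2! [apply: sumr_ge0 => ? _].
have C2_ge0 : 0 <= C2 by do 2! [apply: sumr_ge0 => ? _].
have V_ge0 x : 0 <= V x by rewrite addr_ge0 // mulr_ge0 // (le_trans ler01).
have V_le x : V x <= (1 + `|k| + K) * (C1 * 2) * euclidean_norm x.
  have yle l : `|(invmx P1 *m x) l 0| <= C1 * 2 * euclidean_norm x.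
    apply: le_trans (_ : \sum_l `|(invmx P1 *m x) l 0| <= _).
      by rewrite (bigD1 l) //= lerDl sumr_ge0.
    apply: le_trans (mulmx_sum_le _ _) _; rewrite -mulrA ler_wpM2l //.
    rewrite (@sum_I2 _ _ ord0 ord_max) // mulr_natl mulr2n.
    by rewrite lerD // normr_le_euclidean.
  rewrite -mulrA !mulrDl mul1r lerD //.
    rewrite (le_trans (ler_normD _ _)) // lerD ?yle // normrM ler_wpM2l ?yle //.
  by rewrite ler_wpM2l ?yle // (le_trans ler01).
have le_V x : euclidean_norm x <= C2 * (1 + `|k| + 1) * V x.
  apply: le_trans (euclidean_le_sum x) _.
  rewrite -{1}[x](mulKVmx P1u); apply: le_trans (mulmx_sum_le _ _) _.
  rewrite -mulrA ler_wpM2l // (sum_I2 _ jj') /V.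
  set u := (invmx P1 *m x) j 0; set v := (invmx P1 *m x) j' 0.
  have vV : `|v| <= skew_norm k K u v.
    by rewrite /skew_norm ler_wpDl // ler_peMl.
  have wV : `|u + k * v| <= skew_norm k K u v.
    by rewrite /skew_norm lerDl mulr_ge0 // (le_trans ler01).
  have uV : `|u| <= `|u + k * v| + `|k| * `|v|.
    by rewrite -normrM -[X in `|X| <= _](addrK (k * v)) ler_normB.
  by have := ler_wpM2l (normr_ge0 k) vV; lra.
have alt := modes_alternate swd s0.
have [d0 dS _ _ _] := swd.
apply: (@asymptotically_stable_geometric _ _ _ (fun n => d n.*2)
  (C2 * (1 + `|k| + 1) * B * ((1 + `|k| + K) * (C1 * 2))) r) => //.
  have := le_trans ler01 K1 => K0.
  by rewrite !mulr_ge0 // ?addr_ge0.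
move=> x xtraj.
have flow1 n t : d n.*2 <= t <= d n.*2.+1 -> forall l,
    (invmx P1 *m x t) l 0
    = expR (lam 0 l * (t - d n.*2)) * (invmx P1 *m x (d n.*2)) l 0.
  by apply: (diag_flow_on_stay swd xtraj) => //; rewrite (alt n).1.
have flow2 n t : d n.*2.+1 <= t <= d n.*2.+2 -> forall l,
    (invmx P2 *m x t) l 0
    = expR (mu 0 l * (t - d n.*2.+1)) * (invmx P2 *m x (d n.*2.+1)) l 0.
  by apply: (diag_flow_on_stay swd xtraj) => //; rewrite (alt n).2.
(* A stay in mode 2 is preceded by a complete stay in mode 1. *)
have V_flow2 n t : d n.*2.+1 <= t <= d n.*2.+2 ->
    V (x t) <= B * V (x (d n.*2)) /\ V (x t) <= r * V (x (d n.*2)).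
  move=> /[dup] tI /andP[nt tn].
  have nn : d n.*2 <= d n.*2.+1 <= d n.*2.+1 by rewrite lexx ltW.
  have h0 : 0 <= d n.*2.+1 - d n.*2 by rewrite subr_ge0 ltW.
  have sI : 0 <= t - d n.*2.+1 <= eta.
    by rewrite subr_ge0 nt (le_trans _ (flee n)) // lerD2r.
  have [||VB Vr] := contr _ _ ((invmx P1 *m x (d n.*2)) j 0)
    ((invmx P1 *m x (d n.*2)) j' 0) ((invmx P1 *m x t) j 0)
    ((invmx P1 *m x t) j' 0) h0 sI.
  - by apply: (mulfI Mi'j); rewrite -zi'E (flow2 _ _ tI) zi'E !(flow1 _ _ nn); ring.
  - by apply: (mulfI Mij'); rewrite -ziE (flow2 _ _ tI) ziE !(flow1 _ _ nn); ring.
  by split=> //; exact: Vr.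
have V_flow n t : d n.*2 <= t <= d n.*2.+2 -> V (x t) <= B * V (x (d n.*2)).
  move=> /andP[nt tn]; case: (leP (d n.*2.+1) t) => tmid.
    by have [] := V_flow2 n t; rewrite ?tmid.
  have tI : d n.*2 <= t <= d n.*2.+1 by rewrite nt ltW.
  have h0 : 0 <= t - d n.*2 by rewrite subr_ge0.
  have sI : 0 <= (0 : R) <= eta.
    by rewrite lexx (le_trans _ (flee n)) // subr_ge0 ltW.
  have [||//] := contr _ _ ((invmx P1 *m x (d n.*2)) j 0)
    ((invmx P1 *m x (d n.*2)) j' 0) ((invmx P1 *m x t) j 0)
    ((invmx P1 *m x t) j' 0) h0 sI.
  - by rewrite !(flow1 _ _ tI) mulr0 expR0 mul1r.
  - by rewrite !(flow1 _ _ tI) mulr0 expR0 mul1r.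
have V_period n : V (x (d n.*2)) <= r ^+ n * V (x 0).
  elim: n => [|n IH]; first by rewrite -[_.*2]/0%N d0 expr0 mul1r.
  rewrite doubleS exprS -mulrA.
  have [|_ Vr] := V_flow2 n (d n.*2.+2); first by rewrite lexx ltW.
  by apply: le_trans Vr _; rewrite ler_wpM2l.
move=> n t nt.
have [m nm mt] := switching_period swd nt.
apply: le_trans (le_V (x t)) _; rewrite -!mulrA.
apply: ler_wpM2l => //; apply: ler_wpM2l; first by rewrite !addr_ge0.
apply: le_trans (V_flow m t mt) _; apply: ler_wpM2l => //.
apply: le_trans (V_period m) _.
have rmn : r ^+ m <= r ^+ n.
  by case/andP: r01 => _ r1; apply: ler_wiXn2l => //; exact: ltW.
apply: le_trans (ler_pM _ _ rmn (V_le (x 0))) _ => //; first exact: exprn_ge0.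
by rewrite le_eqVlt; apply/orP; left; apply/eqP; ring.
Qed.

(** * The four positions of the zero entry *)

Theorem theorem4p2 (R : realType) (p1 q1 p2 q2 : R) (P1 P2 A1 A2 M : 'M[R]_2)
    (epsilon eta : R)
    (h1 : 0 < p1 < q1)
    (h2 : 0 < p2 < q2 \/ p2 <= 0 < q2)
    (hP1 : P1 \in unitmx) (hP2 : P2 \in unitmx)
    (hA1 : A1 = P1 *m diag2 (- p1) (- q1) *m invmx P1)
    (hA2 : A2 = P2 *m diag2 p2 q2 *m invmx P2)
    (hM : M = invmx P2 *m P1) (hdetM : \det M = 1)
    (hepsilon : 0 < epsilon) (heta : 0 < eta) :
  (M 0 1 = 0 \/ M 1 0 = 0 ->
    forall sigma : R -> mode,
      dwell_flee (Num.max (q2 / q1) (p2 / p1) * eta + epsilon) eta sigma ->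
      asymptotically_stable (subsystem A1 A2) sigma) /\
  (M 0 0 = 0 \/ M 1 1 = 0 ->
    forall sigma : R -> mode,
      dwell_flee (q2 / p1 * eta + epsilon) eta sigma ->
      asymptotically_stable (subsystem A1 A2) sigma).
Proof.
have /andP[p10 pq1] := h1.
have q10 : 0 < q1 by exact: lt_trans pq1.
have q20 : 0 < q2 by case: h2 => /andP[]; [exact: lt_trans|].
have pq2 : p2 <= q2 by case: h2 => /andP[]; [move=> _; exact: ltW|lra].
(* The margin is a * epsilon. *)
have rate (a b c : R) : 0 < a -> b / a <= c ->
    - a * (c * eta + epsilon) + b * eta < 0.
  move=> a0; rewrite ler_pdivrMr // => /(ler_wpM2r (ltW heta)).
  by have := mulr_gt0 a0 hepsilon; lra.
split=> Mz sigma; [set c := Num.max _ _|set c := q2 / p1] => Ssigma.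
  have cq : q2 / q1 <= c by rewrite le_max lexx.
  have cp : p2 / p1 <= c by rewrite le_max lexx orbT.
  have tau0 : 0 < c * eta + epsilon.
    by rewrite addr_gt0 // mulr_gt0 // (lt_le_trans _ cq) // divr_gt0.
  rewrite hA1 hA2 /diag2; case: Mz; rewrite hM => Mij.
  - by apply: (triangular_asymptotically_stable (i := 0) (i' := 1) (j := 1)
      (j' := 0) _ _ _ _ Mij _ _ tau0 _ _ Ssigma); rewrite ?mxE ?oppr_lt0 ?rate.
  - by apply: (triangular_asymptotically_stable (i := 1) (i' := 0) (j := 0)
      (j' := 1) _ _ _ _ Mij _ _ tau0 _ _ Ssigma); rewrite ?mxE ?oppr_lt0 ?rate.
have cp : q2 / p1 <= c by [].
have cq : p2 / q1 <= c.
  apply: le_trans (_ : q2 / q1 <= _); first by rewrite ler_pM2r ?invr_gt0.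
  by rewrite ler_pM2l // lef_pV2 ?posrE // ltW.
have tau0 : 0 < c * eta + epsilon by rewrite addr_gt0 // mulr_gt0 // divr_gt0.
rewrite hA1 hA2 /diag2; case: Mz; rewrite hM => Mij.
- by apply: (triangular_asymptotically_stable (i := 0) (i' := 1) (j := 0)
    (j' := 1) _ _ _ _ Mij _ _ tau0 _ _ Ssigma); rewrite ?mxE ?oppr_lt0 ?rate.
- by apply: (triangular_asymptotically_stable (i := 1) (i' := 0) (j := 1)
    (j' := 0) _ _ _ _ Mij _ _ tau0 _ _ Ssigma); rewrite ?mxE ?oppr_lt0 ?rate.
Qed.
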